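(* There exists a universal constant $C$ such that, for every graph-hypergraph pair $(G,\mathcal{H})$, if $\epsilon(\mathcal{H})\ge C\log\Delta(\mathcal{H})$, then there is an odd $k$-colouring of $(G,\mathcal{H})$, where $$k\le \chi(G)\cdot C\log\Delta(\mathcal{H}).$$
   Context: All graphs are finite, undirected and simple. A hypergraph $\mathcal{H}=(V(\mathcal{H}),E(\mathcal{H}))$ is a generalisation of a graph whose edges are subsets of $V(\mathcal{H})$ of arbitrary positive size. A graph-hypergraph pair $(G,\mathcal{H})$ consists of a graph $G$ and a hypergraph $\mathcal{H}$ on the same vertex set $V$. $\chi(G)$ is the chromatic number of $G$. $\Delta(\mathcal{H})$ is the maximum degree of $\mathcal{H}$, that is, the maximum, over all vertices $v$, of the number of edges of $\mathcal{H}$ containing $v$; $\epsilon(\mathcal{H})$ is the minimum size of an edge of $\mathcal{H}$. An odd $k$-colouring of $(G,\mathcal{H})$ is a map $\sigma\colon V\to\{1,\dots,k\}$ that is a proper colouring of $G$ (adjacent vertices receive different colours) and such that for every $e\in E(\mathcal{H})$ some colour appears an odd number of times on $e$.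
   Formalization: The maximum degree Δ(H) is assumed to be at least 2: for Δ(H)=1 the bound would read k ≤ 0, which is impossible since the vertex set is nonempty, and for Δ(H)=0 both log Δ(H) and ε(H) are undefined. *)

(* Defs.v *)
From HB Require Import structures.
From mathcomp Require Import all_boot all_order all_algebra.
From mathcomp Require Import reals exp.

Set Implicit Arguments.
Unset Strict Implicit.
Unset Printing Implicit Defensive.

Record graph (V : finType) := Graph {
  adj :> rel V;
  adj_sym : symmetric adj;
  adj_irr : irreflexive adj
}.

Record hypergraph (V : finType) := Hypergraph {
  hedges : {set {set V}};
  hedges_pos : forall e, e \in hedges -> 0 < #|e|
}.

Section GraphHypergraphPairs.
Variable V : finType.
Implicit Types (G : graph V) (H : hypergraph V).

Definition proper_colouring G k (f : V -> 'I_k) : Prop :=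
  forall x y, G x y -> f x <> f y.

Definition colourable G k : bool :=
  [exists f : {ffun V -> 'I_k}, [forall x, forall y, G x y ==> (f x != f y)]].

Lemma colourableP G k :
  reflect (exists f : V -> 'I_k, proper_colouring G f) (colourable G k).
Proof.
apply: (iffP existsP) => [[f /forallP fP] | [f fP]].
  exists f => x y Gxy; apply/eqP; move/forallP: (fP x) => /(_ y).
  by rewrite Gxy.
exists (finfun f); apply/forallP => x; apply/forallP => y; apply/implyP => Gxy.
by rewrite !ffunE; apply/eqP; apply: fP.
Qed.

Lemma ex_colourable G : exists k, colourable G k.
Proof.
exists #|V|; apply/colourableP; exists enum_rank => x y Gxy /enum_rank_inj xy.
by rewrite xy adj_irr in Gxy.
Qed.

Definition chromatic_number G : nat := ex_minn (ex_colourable G).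

Definition hdegree H (v : V) : nat := #|[set e in hedges H | v \in e]|.

Definition max_hdegree H : nat := \max_(v : V) hdegree H v.

(* The default #|V| bounds every edge size, so it is only ever the value when *)
(* it is attained by an edge or there are no edges at all.                    *)
Definition min_edge_size H : nat := \big[minn/#|V|]_(e in hedges H) #|e|.

Lemma min_edge_size_le H e : e \in hedges H -> min_edge_size H <= #|e|.
Proof.
move=> eH; rewrite /min_edge_size -big_filter.
have: e \in [seq f <- index_enum {set V} | f \in hedges H].
  by rewrite mem_filter eH mem_index_enum.
elim: [seq _ <- _ | _] => // f s IHs.
rewrite inE big_cons geq_min => /orP[/eqP-> | /IHs->]; first by rewrite leqnn.
by rewrite orbT.
Qed.

Lemma min_edge_size_attained H :
  hedges H != set0 -> exists2 e, e \in hedges H & min_edge_size H = #|e|.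
Proof.
case/set0Pn => e0 e0H.
have [e eH emin] := arg_minnP (fun e : {set V} => #|e|) e0H.
exists e => //; apply/eqP; rewrite eqn_leq min_edge_size_le //=.
rewrite /min_edge_size; elim/big_ind: _ => [|m n|f /emin //].
  exact: max_card.
by rewrite leq_min => -> ->.
Qed.

Definition odd_colouring G H k (f : V -> 'I_k) : Prop :=
  proper_colouring G f /\
  forall e, e \in hedges H -> exists c : 'I_k, odd #|[set v in e | f v == c]|.

End GraphHypergraphPairs.

(* Main.v *)
Require Import Defs.
From HB Require Import structures.
From mathcomp Require Import all_boot all_order all_algebra.
From mathcomp Require Import reals exp.
From mathcomp Require Import zify.

(** The vertices are coloured with pairs: a proper colouring of [G] with
    [chromatic_number G] colours takes care of [G], and a second colouring with
    O(log D) colours, where D is the maximum degree of [H], gives every edge a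
    colour of odd multiplicity.  Passing to pairs splits that odd colour class
    into parts, one of which is again odd ([odd_colouring_of_product]), and
    multiplies the numbers of colours.

    Let t be of order log D, at most the minimum edge size, and let T be a set
    of at least 16 t colours.  A uniformly random colouring of t vertices hits
    a prescribed set of odd colours with probability at most 2 ^ -t
    ([card_odd_colours_eq]).  Edges may be much larger than t, so that an edge
    may meet an unbounded number of others and the symmetric local lemma does
    not apply directly.  But in an edge e one may fix any t vertices U and
    condition on the colours outside U: e has no odd colour exactly when U has
    the same odd colours as e \ U, so the bound 2 ^ -t survives the
    conditioning ([card_bad_colourings]).

    This feeds an inductive counting argument in the style of Rosenfeld.  Let
    N(S) be the number of maps V -> T for which every edge inside S has an odd
    colour.  The claim is that adding a vertex v to S keeps at least 3/4 of
    them.  What is lost is spoilt by some edge e through v inside v |: S; with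
    v \in U \subset e and |U| = t, such maps number at most
    2 ^ -t * N(S \ U), which by induction is at most
    2 ^ -t * (4/3) ^ (t-1) * N(S).  At most D edges pass through v, and
    3 D 2 ^ t <= 3 ^ t makes the total loss at most N(S) / 4.  Hence
    N(V) >= (3/4) ^ |V| * N(set0) > 0. *)

Set Implicit Arguments.
Unset Strict Implicit.
Unset Printing Implicit Defensive.

Import Order.TTheory GRing.Theory Num.Theory.

(** * Parities of colour classes *)

Section OddColours.
Variables (V T : finType).
Implicit Types (f g : {ffun V -> T}) (A B S U e : {set V}) (w : {set T}).
Implicit Types (F : {set {ffun V -> T}}).

Definition odd_colours f A : {set T} :=
  [set c | odd #|[set v in A | f v == c]|].

Lemma in_odd_colours_setU f A B c : [disjoint A & B] ->
  (c \in odd_colours f (A :|: B))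
    = (c \in odd_colours f A) (+) (c \in odd_colours f B).
Proof.
move=> dAB; rewrite !inE -oddD; congr odd.
rewrite -cardsUI [X in (_ + X)%N]eq_card0 ?addn0.
  by apply: eq_card => v; rewrite !inE andb_orl.
move=> v; rewrite !inE; case vA: (v \in A) => //=.
by rewrite (disjointFr dAB vA) /= andbF.
Qed.

Lemma in_odd_colours_set1 f u c : (c \in odd_colours f [set u]) = (f u == c).
Proof.
rewrite inE; case: eqP => [fu | /eqP fu].
  rewrite (_ : [set v in _ | _] = [set u]) ?cards1 //.
  by apply/setP => v; rewrite !inE; case: eqP => // ->; rewrite fu eqxx.
rewrite eq_card0 // => v; rewrite !inE; case: eqP => // ->.
by rewrite (negbTE fu).
Qed.

Lemma card_odd_colours f A : #|odd_colours f A| <= #|A|.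
Proof.
apply: leq_trans (leq_imset_card f A); apply/subset_leq_card/subsetP => c.
rewrite inE => /odd_gt0/card_gt0P[v].
by rewrite inE => /andP[vA /eqP<-]; apply: imset_f.
Qed.

Lemma eq_odd_colours f g A : {in A, f =1 g} -> odd_colours f A = odd_colours g A.
Proof.
move=> fg; apply/setP => c; rewrite !inE; congr odd; apply: eq_card => v.
by rewrite !inE; case vA: (v \in A) => //=; rewrite fg.
Qed.

(** Membership in such an [F] is an event determined by the colours outside
    [U]: given that the event occurs, a uniformly random colouring is still
    uniform and independent on [U]. *)
Definition free_on U F :=
  forall f g, {in ~: U, f =1 g} -> f \in F -> g \in F.

(** Recolouring [u] is a bijection between the fibres, so they are all equally
    large. *)
Lemma card_fibre_free u F c :
  free_on [set u] F -> #|T| * #|[set f in F | f u == c]| = #|F|.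
Proof.
move=> freeF.
have le_fibre a b : #|[set f in F | f u == a]| <= #|[set f in F | f u == b]|.
  pose upd f := [ffun v => if v == u then b else f v].
  rewrite -(card_in_imset (f := upd)).
    apply/subset_leq_card/subsetP => _ /imsetP[f + ->].
    rewrite inE => /andP[fF _]; rewrite inE ffunE !eqxx andbT.
    by apply: freeF fF => v; rewrite !inE ffunE => /negbTE->.
  move=> f g; rewrite !inE => /andP[_ /eqP fu] /andP[_ /eqP gu] /ffunP fg.
  apply/ffunP => v; have := fg v; rewrite !ffunE; case: eqP => // -> _.
  by rewrite fu gu.
have -> : #|F| = \sum_(a : T) #|[set f in F | f u == a]|.
  rewrite -sum1_card (partition_big (fun f : {ffun V -> T} => f u) predT) //=.
  apply: eq_bigr => a _; rewrite -sum1_card; apply: eq_bigl => f.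
  by rewrite inE.
rewrite -sum_nat_const; apply: eq_bigr => a _; apply/eqP.
by rewrite eqn_leq !le_fibre.
Qed.

(** Reveal the colours of [U] one by one, and let d be the number of colours
    whose parity still has to change.  A step lowers d with probability d / #|T|
    and raises it otherwise.  The target is still within reach only while d is
    at most the number of remaining vertices, hence at most #|T| / 16, and then
    lowering steps are rare.  The factor [4 ^ #|w|]
    is the potential that pays for this: the bound 2 ^ -n * 4 ^ -d on the
    success probability is inductive because
    (1/16) * 4 ^ -(d-1) + 4 ^ -(d+1) = (1/2) * 4 ^ -d. *)
Lemma card_odd_colours_eq U F w :
    16 * #|U| <= #|T| -> free_on U F ->
  #|[set f in F | odd_colours f U == w]| * 2 ^ #|U| * 4 ^ #|w| <= #|F|.
Proof.
move: {2}#|U| (erefl #|U|) => n; elim: n U F w => [|n IHn] U F w cardU.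
  move=> _ _; rewrite cardU muln1.
  have O0 f : odd_colours f U = set0.
    by apply/eqP; rewrite -cards_eq0 -leqn0 -cardU card_odd_colours.
  have [->|w0] := eqVneq w set0.
    rewrite cards0 muln1 subset_leq_card //.
    by apply/subsetP => f; rewrite inE => /andP[].
  rewrite eq_card0 // => f; rewrite inE O0 eq_sym (negbTE w0) andbF //.
move=> leUT freeF.
(* A target with more colours than vertices cannot be reached; beyond this case
   #|w| is at most #|T| / 16. *)
have [ltUw | lewU] := ltnP #|U| #|w|.
  rewrite eq_card0 // => f; rewrite inE; apply/negbTE/negP => /andP[_ /eqP fw].
  by have := card_odd_colours f U; rewrite fw leqNgt ltUw.
have /card_gt0P[u uU] : 0 < #|U| by rewrite cardU.
have cardU' : #|U :\ u| = n by move: (cardsD1 u U); rewrite uU cardU; lia.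
(* [flip c] is the target left for U :\ u once u has received colour c. *)
pose flip c := [set d | (d \in w) (+) (c == d)].
have oddU f : (odd_colours f U == w) = (odd_colours f (U :\ u) == flip (f u)).
  have EU c : (c \in odd_colours f U)
      = (f u == c) (+) (c \in odd_colours f (U :\ u)).
    rewrite -{1}(setD1K uU) in_odd_colours_setU ?in_odd_colours_set1 //.
    by rewrite disjoints1 !inE eqxx.
  apply/eqP/eqP => E; apply/setP => c.
    by rewrite [in RHS]inE -E EU addbAC addbb.
  by rewrite EU E inE addbCA addbb addbF.
pose Fc c := [set f in F | f u == c].
pose X c := #|[set f in Fc c | odd_colours f (U :\ u) == flip c]|.
have -> : #|[set f in F | odd_colours f U == w]| = \sum_c X c.
  rewrite -sum1_card (partition_big (fun f : {ffun V -> T} => f u) predT) //=.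
  apply: eq_bigr => c _; rewrite /X -sum1_card; apply: eq_bigl => f.
  rewrite !inE oddU andbAC; case: (eqVneq (f u) c) => [->|_] //.
  by rewrite !andbF.
have IHc c : X c * 2 ^ n * 4 ^ #|flip c| <= #|Fc c|.
  rewrite -{1}cardU'; apply: IHn => //; first lia.
  move=> f g fg; rewrite !inE => /andP[fF /eqP fc].
  rewrite -fg ?fc ?inE ?eqxx // andbT; apply: freeF fF => v.
  by rewrite inE => vU; apply: fg; rewrite !inE (negbTE vU) andbF.
have cardFc c : #|T| * #|Fc c| = #|F|.
  apply: card_fibre_free => f g fg; apply: freeF => v; rewrite inE => vU.
  by apply: fg; rewrite !inE; apply: contraNneq vU => ->.
have Xin c : c \in w -> 2 * (X c * 2 ^ n.+1 * 4 ^ #|w|) <= 16 * #|Fc c|.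
  move=> cw; have <- : (#|flip c|).+1 = #|w|.
    rewrite [RHS](cardsD1 c) cw; congr _.+1; apply: eq_card => d; rewrite !inE.
    by case: (eqVneq c d) => [<-|/= _]; rewrite ?cw ?addbF ?andbT.
  have := IHc c; rewrite !expnS; lia.
have Xout c : c \notin w -> 2 * (X c * 2 ^ n.+1 * 4 ^ #|w|) <= #|Fc c|.
  move=> cw; have E : #|flip c| = (#|w|).+1.
    rewrite (cardsD1 c) !inE (negbTE cw) eqxx; congr _.+1; apply: eq_card => d.
    by rewrite !inE; case: (eqVneq c d) => [<-|/= _]; rewrite ?(negbTE cw) ?addbF ?andbT.
  have := IHc c; rewrite E !expnS; lia.
have [T0|Tgt0] := posnP #|T|; first lia.
(* Of the colours for u, #|w| lower the distance and the others raise it. *)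
have le2 : 2 * ((\sum_c X c) * 2 ^ n.+1 * 4 ^ #|w|) * #|T|
    <= (16 * #|w| + #|T|) * #|F|.
  rewrite mulnC !big_distrl !big_distrr /= (bigID [in w]) /= mulnDl leq_add //.
    rewrite -mulnA mulnCA -sum_nat_const leq_sum // => c cw.
    by rewrite -(cardFc c) [leqRHS]mulnCA leq_mul // Xin.
  apply: (@leq_trans (\sum_(c | c \notin w) #|F|)).
    by apply: leq_sum => c cw; rewrite -(cardFc c) leq_mul // Xout.
  by rewrite sum_nat_const leq_mul // max_card.
rewrite cardU -(leq_pmul2l Tgt0) -(@leq_pmul2l 2) //.
apply: leq_trans (_ : (16 * #|w| + #|T|) * #|F| <= _); first lia.
by rewrite mulnA leq_mul //; lia.
Qed.

(** No colour is odd on [A] exactly when [U] and its complement in [A] have the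
    same odd colours.  Splitting [F] by the latter set, which the colours
    outside [U] determine, leaves a fixed target for [U]. *)
Lemma card_bad_colourings U A F :
    16 * #|U| <= #|T| -> U \subset A -> free_on U F ->
  #|[set f in F | odd_colours f A == set0]| * 2 ^ #|U| <= #|F|.
Proof.
move=> leUT UA freeF; pose Fw w := [set f in F | odd_colours f (A :\: U) == w].
have oddA f : (odd_colours f A == set0)
    = (odd_colours f U == odd_colours f (A :\: U)).
  have EA c : (c \in odd_colours f A)
      = (c \in odd_colours f U) (+) (c \in odd_colours f (A :\: U)).
    rewrite -in_odd_colours_setU; first by rewrite -{1}(setIidPr UA) setID.
    by rewrite -setI_eq0 setIDA setDIl setDv set0I.
  apply/eqP/eqP => E; apply/setP => c; last by rewrite EA E addbb inE.
  by move/setP/(_ c): E; rewrite EA in_set0; do 2 case: (c \in _).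
have -> : #|F| = \sum_w #|Fw w|.
  rewrite -sum1_card (partition_big (odd_colours^~ (A :\: U)) predT) //=.
  by apply: eq_bigr => w _; rewrite /Fw -sum1_card; apply: eq_bigl => f; rewrite inE.
rewrite -sum1_card (partition_big (odd_colours^~ (A :\: U)) predT) //=.
rewrite big_distrl leq_sum //= => w _.
have freeFw : free_on U (Fw w).
  move=> f g fg; rewrite !inE => /andP[fF /eqP <-].
  rewrite (freeF _ _ fg fF) /= (@eq_odd_colours g f) // => v.
  by rewrite inE => /andP[vU _]; rewrite fg // inE.
have := card_odd_colours_eq w leUT freeFw; apply: leq_trans.
rewrite -[X in X <= _]muln1 leq_mul ?expn_gt0 // leq_mul //.
rewrite sum1_card subset_leq_card //; apply/subsetP => f; rewrite unfold_in /=.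
by rewrite !inE oddA => /andP[/andP[-> /eqP->] ->].
Qed.

(** * Counting colourings with odd colours *)

Section Growth.
Variables (H : hypergraph V) (t : nat).
Hypotheses (t_gt0 : 0 < t) (leT : 16 * t <= #|T|).
Hypothesis edge_size : forall e, e \in hedges H -> t <= #|e|.
Hypothesis degree_bound : 3 * max_hdegree H * 2 ^ t <= 3 ^ t.

Definition good_colourings (S : {set V}) : {set {ffun V -> T}} :=
  [set f | [forall e in hedges H, (e \subset S) ==> (odd_colours f e != set0)]].

Lemma good_colouringsP S f :
  reflect (forall e, e \in hedges H -> e \subset S -> odd_colours f e != set0)
          (f \in good_colourings S).
Proof.
rewrite inE; apply: (iffP forall_inP) => good e eH; first exact/implyP/(good e).
by apply/implyP/good.
Qed.

Lemma good_colourings_sub A S :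
  A \subset S -> good_colourings S \subset good_colourings A.
Proof.
move=> AS; apply/subsetP => f /good_colouringsP good.
by apply/good_colouringsP => e eH eA; apply: good => //; apply: subset_trans AS.
Qed.

Lemma good_colourings_free U S :
  free_on U (good_colourings (S :\: U)).
Proof.
move=> f g fg /good_colouringsP good; apply/good_colouringsP => e eH eS.
rewrite -(@eq_odd_colours f g) ?good // => v /(subsetP eS).
by rewrite inE => /andP[vU _]; rewrite fg // inE.
Qed.

(** The set to be resampled must contain the vertex being added: then only
    t - 1 of its vertices lie in the old vertex set. *)
Lemma subset_through e v : e \in hedges H -> v \in e ->
  exists U : {set V}, [/\ U \subset e, v \in U & #|U| = t].
Proof.
move=> eH ve; have [s /andP[us ss] szs] :
    exists2 s, uniq s && all [in e :\ v] s & size s = t.-1.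
  exists (take t.-1 (enum (e :\ v))).
    rewrite take_uniq ?enum_uniq //=; apply/allP => x /mem_take.
    by rewrite mem_enum.
  rewrite size_take -cardE; have := edge_size eH.
  rewrite (cardsD1 v e) ve; case: ltnP; lia.
have vs : v \notin s by apply/negP => /(allP ss); rewrite !inE eqxx.
exists [set x in v :: s]; split; last 2 first.
- by rewrite !inE eqxx.
- have /card_uniqP : uniq (v :: s) by rewrite /= vs.
  by rewrite cardsE => -> /=; rewrite szs prednK.
apply/subsetP => x; rewrite !inE => /orP[/eqP->//|/(allP ss)].
by rewrite !inE => /andP[].
Qed.

(** A colouring lost when [v] is added is spoilt by an edge [e] through [v].
    Forgetting the edges that meet a [t]-subset [U] of [e] through [v] makes the
    colouring free on [U], at the price of a factor (4/3) ^ (t-1), and then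
    [card_bad_colourings] applies. *)
Lemma card_good_step S v : v \notin S ->
    (forall A, A \subset S -> 3 ^ #|S :\: A| * #|good_colourings A|
                           <= 4 ^ #|S :\: A| * #|good_colourings S|) ->
  3 * #|good_colourings S| <= 4 * #|good_colourings (v |: S)|.
Proof.
move=> vS growth; pose S' := v |: S; pose N := #|good_colourings S|.
pose bad e := [set f in good_colourings S | odd_colours f e == set0].
pose E := [set e in hedges H | v \in e & e \subset S'].
have bad_le e : e \in E -> 4 * 3 ^ t * #|bad e| <= 3 * 2 ^ t * N.
  rewrite inE => /and3P[eH ve eS'].
  have [U [Ue vU cardU]] := subset_through eH ve.
  (* The colours on U are free among the colourings good for S :\: U, and these
     contain the colourings good for S. *)
  have := card_bad_colourings (_ : 16 * #|U| <= #|T|) Ue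
    (good_colourings_free (U := U) (S := S)).
  rewrite cardU => /(_ leT) le1.
  have le2 : #|bad e| * 2 ^ t <= #|good_colourings (S :\: U)|.
    apply: leq_trans le1; rewrite leq_mul // subset_leq_card //.
    apply/subsetP => f; rewrite !inE => /andP[fS ->]; rewrite andbT.
    by have := subsetP (good_colourings_sub (subsetDl S U)) f; rewrite !inE; apply.
  have := growth _ (subsetDl S U).
  have -> : #|S :\: (S :\: U)| = t.-1.
    rewrite setDDr setDv set0U -cardU (cardsD1 v U) vU; apply: eq_card => x.
    rewrite !inE; have [->|xv] := eqVneq x v; first by rewrite (negbTE vS).
    rewrite andbC; case xU: (x \in U) => //=.
    by have := subsetP eS' x (subsetP Ue x xU); rewrite !inE (negbTE xv).
  rewrite -/N => le3; have [t' Et] : exists t', t = t'.+1 by exists t.-1; lia.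
  move: le2 le3; rewrite Et /= !expnS -[4]/(2 * 2) expnMn.
  move: (good_colourings _) => /= G' le2 le3.
  (* Chain le2, scaled by 3 ^ (t-1), with le3; the common factor 2 ^ (t-1)
     comes from 4 ^ (t-1) = 2 ^ (t-1) * 2 ^ (t-1). *)
  have p2 : 0 < 2 ^ t' by rewrite expn_gt0.
  rewrite -(leq_pmul2l p2).
  have := leq_mul (leqnn (3 ^ t')) le2; nia.
have cover : good_colourings S :\: good_colourings S' \subset \bigcup_(e in E) bad e.
  apply/subsetP => f /setDP[fS /good_colouringsP nfS'].
  apply/bigcupP/exists_inP; apply: contraT => /exists_inPn none; case: nfS'.
  move=> e eH eS'; apply/negP => oe0.
  have [ve | ve] := boolP (v \in e).
    have eE : e \in E by rewrite inE eH ve.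
    by have := none e eE; move: fS; rewrite !inE oe0 andbT => ->.
  have eS : e \subset S.
    apply/subsetP => x xe; have := subsetP eS' x xe; rewrite !inE.
    by case: eqP => // xv; rewrite -xv xe in ve.
  by have /good_colouringsP/(_ e eH eS) := fS; rewrite oe0.
have union_bound : #|\bigcup_(e in E) bad e| <= \sum_(e in E) #|bad e|.
  elim/big_rec2: _ => [|e a B _ le]; first by rewrite cards0.
  by apply: leq_trans (leq_add (leqnn _) le); rewrite leq_card_setU.
have cardE : #|E| <= max_hdegree H.
  apply: leq_trans (leq_bigmax v); apply: subset_leq_card.
  by apply/subsetP => e; rewrite !inE => /and3P[-> ->].
(* Here the degree bound enters: the sum is at most N / 4. *)
have sum_le : 4 * 3 ^ t * \sum_(e in E) #|bad e| <= 3 ^ t * N.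
  apply: (@leq_trans (#|E| * (3 * 2 ^ t * N))).
    by rewrite big_distrr -sum_nat_const leq_sum.
  apply: (@leq_trans (3 * max_hdegree H * 2 ^ t * N)); last by rewrite leq_mul.
  apply: leq_trans (leq_mul cardE (leqnn _)) _; lia.
have lost := leq_trans (subset_leq_card cover) union_bound.
have := cardsID (good_colourings S') (good_colourings S).
rewrite (setIidPr (good_colourings_sub (subsetUr _ _))) -/N -/S' => NE.
have p3 : 0 < 3 ^ t by rewrite expn_gt0.
have : 4 * \sum_(e in E) #|bad e| <= N by rewrite -(leq_pmul2l p3); lia.
lia.
Qed.

(** Iterating [card_good_step], whose own hypothesis is this growth estimate for
    a smaller set; so both are obtained in one induction on #|S|. *)
Lemma card_good_growth S A : A \subset S ->
  3 ^ #|S :\: A| * #|good_colourings A| <= 4 ^ #|S :\: A| * #|good_colourings S|.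
Proof.
move: {2}#|S| (leqnn #|S|) => n; elim: n S A => [|n IHn] S A leSn AS.
  have S0 : S = set0 by apply/eqP; rewrite -cards_eq0 -leqn0.
  by move: AS; rewrite S0 subset0 => /eqP->; rewrite setDv cards0.
have [SA | /set0Pn[v]] := eqVneq (S :\: A) set0.
  have -> : A = S by apply/eqP; rewrite eqEsubset AS -setD_eq0 SA eqxx.
  by rewrite setDv cards0.
rewrite inE => /andP[vA vS].
have leSn' : #|S :\ v| <= n by move: leSn; rewrite (cardsD1 v S) vS.
have AS' : A \subset S :\ v by rewrite subsetD1 AS.
have := @card_good_step (S :\ v) v; rewrite setD11 setD1K // => /(_ isT) step.
have {}step := step (fun B => IHn _ B leSn').
have -> : #|S :\: A| = #|(S :\ v) :\: A|.+1.
  rewrite (cardsD1 v) !inE vA vS; congr _.+1; apply: eq_card => x.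
  by rewrite !inE andbCA.
have := IHn _ _ leSn' AS'; rewrite !expnS; move: (_ ^ _) (_ ^ _) => a b.
move: step; move: (#|_|) (#|_|) (#|_|) => x y z; nia.
Qed.

Lemma ex_odd_colours_neq0 :
  exists f : V -> T, forall e, e \in hedges H ->
    exists c, odd #|[set v in e | f v == c]|.
Proof.
have /card_gt0P[f /good_colouringsP good] : 0 < #|good_colourings setT|.
  have := card_good_growth (sub0set setT); case: posnP => // ->.
  rewrite muln0 leqn0 muln_eq0 expn_eq0 /= cards_eq0 => /eqP/setP none.
  have /card_gt0P[c _] : 0 < #|T| by lia.
  have := none [ffun=> c]; rewrite [in RHS]inE => /good_colouringsP[].
  move=> e eH; rewrite subset0 => /eqP e0.
  by have := edge_size eH; rewrite e0 cards0; lia.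
exists f => e eH; have /set0Pn[c] := good e eH (subsetT _).
by rewrite inE => oc; exists c.
Qed.

End Growth.
End OddColours.

(** * The product colouring and the theorem *)

(** An odd class of [f] on an edge is the disjoint union of classes of the pair
    colouring, and a sum of even numbers would be even. *)
Lemma odd_colouring_of_product (V T : finType) (G : graph V) (H : hypergraph V)
    (k : nat) (g : V -> 'I_k) (f : V -> T) :
    proper_colouring G g ->
    (forall e, e \in hedges H -> exists c, odd #|[set v in e | f v == c]|) ->
  exists sigma : V -> 'I_(#|{: 'I_k * T}|), odd_colouring G H sigma.
Proof.
move=> gP fP; exists (fun v => enum_rank (g v, f v)); split=> [x y Gxy|e eH].
  by move=> /enum_rank_inj[gxy _]; exact: gP Gxy gxy.
have [c oc] := fP e eH.
have [i oi] : exists i, odd #|[set v in e | (g v, f v) == (i, c)]|.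
  apply/existsP; apply: contraLR oc => /existsPn none.
  rewrite -sum1_card (partition_big g predT) //=.
  elim/big_ind: _ => // [a b|i _]; first by rewrite oddD => /negbTE-> /negbTE->.
  apply: contraNN (none i); rewrite -sum1_card.
  rewrite (eq_bigl [in [set v in e | (g v, f v) == (i, c)]]) ?sum1_card //.
  by move=> v; rewrite !inE xpair_eqE -andbA [_ && (g v == i)]andbC.
exists (enum_rank (i, c)); move: oi; congr odd; apply: eq_card => v.
by rewrite !inE (inj_eq enum_rank_inj).
Qed.

(** With l = trunc_log 2 D >= 1 one has D < 2 ^ (l+1), and the claim reduces to
    (6 * 2 ^ 8) ^ l = 1536 ^ l <= 2187 ^ l = (3 ^ 7) ^ l; this is what the factor 7 is for. *)
Lemma degree_bound_trunc_log D : 1 < D ->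
  3 * D * 2 ^ (7 * trunc_log 2 D) <= 3 ^ (7 * trunc_log 2 D).
Proof.
move=> D1; have D2 : D < 2 ^ (trunc_log 2 D).+1 by apply: trunc_log_ltn.
have l_gt0 : 0 < trunc_log 2 D by rewrite trunc_log_gt0.
move: (trunc_log 2 D) D2 l_gt0 => [//|l] D2 _.
apply: (@leq_trans (3 * 2 ^ l.+2 * 2 ^ (7 * l.+1))); first by rewrite !leq_mul // ltnW.
rewrite !(expnM _ 7) (_ : 2 ^ 7 = 128) // (_ : 3 ^ 7 = 2187) //.
rewrite -mulnA [2 ^ l.+2]expnS -mulnA -expnMn mulnA.
apply: (@leq_trans (6 ^ l.+1 * 256 ^ l.+1)).
  by rewrite leq_mul // -[X in X <= _]expn1 leq_exp2l.
by rewrite -expnMn leq_exp2r.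
Qed.

Local Open Scope ring_scope.

Theorem theorem1p6 (R : realType) :
  exists C : R,
    forall (V : finType) (G : graph V) (H : hypergraph V),
      (1 < max_hdegree H)%N ->
      (min_edge_size H)%:R >= C * ln (max_hdegree H)%:R ->
      exists k : nat,
        k%:R <= (chromatic_number G)%:R * (C * ln (max_hdegree H)%:R) /\
        exists sigma : V -> 'I_k, odd_colouring G H sigma.
Proof.
(* 112 = 16 * 7: with t = 7 l, both t and the 16 t colours of the second
   colouring are bounded by C ln D, since l <= ln D / ln 2. *)
exists (112%:R / ln 2) => V G H D1 size_ge; pose l := trunc_log 2 (max_hdegree H).
have le_ln : (16 * (7 * l))%:R <= 112%:R / ln 2 * ln (max_hdegree H)%:R :> R.
  have ln2 : 0 < ln 2 :> R by rewrite ln_gt0 // ltr1n.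
  rewrite mulnA natrM -mulrA ler_wpM2l // mulrC ler_pdivlMr // mulrC.
  rewrite mulr_natr -lnXn // ler_ln ?posrE ?exprn_gt0 ?ltr0n //; last lia.
  by rewrite -natrX ler_nat; apply: trunc_logP => //; lia.
have t_gt0 : (0 < 7 * l)%N by rewrite muln_gt0 trunc_log_gt0.
have leT : (16 * (7 * l) <= #|'I_(16 * (7 * l))|)%N by rewrite card_ord.
have edge_size e : e \in hedges H -> (7 * l <= #|e|)%N.
  move=> /min_edge_size_le; apply: leq_trans.
  by have := le_trans le_ln size_ge; rewrite ler_nat; lia.
have [f fP] := ex_odd_colours_neq0 t_gt0 leT edge_size (degree_bound_trunc_log D1).
have /colourableP[g gP] : colourable G (chromatic_number G).
  by rewrite /chromatic_number; case: ex_minnP.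
exists #|{: 'I_(chromatic_number G) * 'I_(16 * (7 * l))}|; split.
  by rewrite card_prod !card_ord natrM ler_wpM2l.
exact: odd_colouring_of_product gP fP.
Qed.
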